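(* There is an online algorithm $A$ for $\textsc{linear}$ $\mathrm{BMC}$ that is $O(1)$-competitive on instances with $\ell_t=O(r_t)$: for every constant $\alpha\ge1$ there is a constant $c_\alpha$ such that $A(\mathcal I)\le c_\alpha\,\mathrm{OPT}(\mathcal I)$ for every instance $\mathcal I=\langle(\ell_t,r_t)\rangle_t$ satisfying $\ell_t\le\alpha\, r_t$ for all $t$.
   Context: $\textsc{linear}$ $\mathrm{BMC}$: input is $\mathcal I=\langle(\ell_t,r_t)\rangle_{t=1}^n$, pairs of nonnegative reals, revealed one at a time. An algorithm maintains a stack of lengths, initially empty. At time $t$, $(\ell_t,r_t)$ is revealed and $\ell_t$ is pushed on top; then the algorithm chooses a nonempty contiguous sequence of lengths at the top of the stack and replaces them by their sum $L_t$. The cost is $\sum_{t=1}^n L_t+r_tk_t$, where $k_t$ is the stack size after the compaction at time $t$; $\mathrm{OPT}(\mathcal I)$ is the minimum cost over all schedules, and $A(\mathcal I)$ the cost incurred by $A$. An algorithm is online if its choice at time $t$ depends only on $(\ell_1,r_1),\dots,(\ell_t,r_t)$. *)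

(* Defs.v *)
From mathcomp Require Import all_boot all_order all_algebra.
From mathcomp Require Import boolp classical_sets reals.

Set Implicit Arguments.
Unset Strict Implicit.
Unset Printing Implicit Defensive.
Import Order.TTheory GRing.Theory Num.Theory.
Local Open Scope classical_set_scope.
Local Open Scope ring_scope.

(* The t-th pair (counted from 0) of an input sequence is (l_{t+1}, r_{t+1}). *)
Definition is_instance (R : realType) (I : seq (R * R)) : bool :=
  all (fun q => (0 <= q.1) && (0 <= q.2)) I.

(* Stacks are listed from top to bottom; [compact m s] merges the top [m]
   lengths. *)
Definition compact (R : realType) (m : nat) (s : seq R) : seq R :=
  (\sum_(x <- take m s) x) :: drop m s.

(* [ms] lists, for each time step, the number of top lengths that are merged;
   [s] is the stack before the first of these steps. *)
Fixpoint feasible_from (R : realType) (s : seq R) (I : seq (R * R))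
    (ms : seq nat) : bool :=
  match I, ms with
  | [::], [::] => true
  | q :: I', m :: ms' =>
      (0 < m <= size (q.1 :: s))%N &&
      feasible_from (compact m (q.1 :: s)) I' ms'
  | _, _ => false
  end.

(* After a compaction, the head of the stack is L_t and its size is k_t. *)
Fixpoint cost_from (R : realType) (s : seq R) (I : seq (R * R))
    (ms : seq nat) : R :=
  match I, ms with
  | q :: I', m :: ms' =>
      let s' := compact m (q.1 :: s) in
      head 0 s' + q.2 * (size s')%:R + cost_from s' I' ms'
  | _, _ => 0
  end.

Definition schedule (R : realType) (I : seq (R * R)) (ms : seq nat) : bool :=
  feasible_from [::] I ms.

Definition cost (R : realType) (I : seq (R * R)) (ms : seq nat) : R :=
  cost_from [::] I ms.

(* This infimum is a minimum: see [OPT_attained] and [OPT_le]. *)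
Definition OPT (R : realType) (I : seq (R * R)) : R :=
  inf [set cost I ms | ms in [set ms | schedule I ms]].

(* A deterministic algorithm, viewed as the map from inputs to the schedules
   that it produces. *)
Definition algorithm (R : realType) (A : seq (R * R) -> seq nat) : Prop :=
  forall I, is_instance I -> schedule I (A I).

Definition online (R : realType) (A : seq (R * R) -> seq nat) : Prop :=
  forall (I J : seq (R * R)) (t : nat),
    is_instance I -> is_instance J -> (t < size I)%N -> (t < size J)%N ->
    take t.+1 I = take t.+1 J -> nth 0%N (A I) t = nth 0%N (A J) t.

Definition alg_cost (R : realType) (A : seq (R * R) -> seq nat)
    (I : seq (R * R)) : R :=
  cost I (A I).

Lemma min_cost_from (R : realType) (I : seq (R * R)) (s : seq R) :
  exists2 ms, feasible_from s I ms &
    forall ms', feasible_from s I ms' -> cost_from s I ms <= cost_from s I ms'.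
Proof.
elim: I s => [|q I IH] s; first by exists [::] => // -[].
have {IH} /choice[f Hf] : forall s, exists ms, feasible_from s I ms /\
    forall ms', feasible_from s I ms' -> cost_from s I ms <= cost_from s I ms'.
  by move=> u; have [ms] := IH u; exists ms.
pose g (i : 'I_(size s).+1) := i.+1 :: f (compact i.+1 (q.1 :: s)).
case: (@Order.TotalTheory.arg_minP _ R _ ord0 xpredT
         (fun i => cost_from s (q :: I) (g i)) isT) => i _ Hi.
exists (g i).
  by rewrite /= ltn_ord /=; have [] := Hf (compact i.+1 (q.1 :: s)).
case=> [//|m ms'] /andP[/andP[m0 ms] Hms'].
case: m m0 ms Hms' => [//|m] _ ms Hms'.
apply: le_trans (Hi (Ordinal ms) isT) _.
rewrite /= lerD2l; exact: (Hf _).2.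
Qed.

Lemma OPT_attained (R : realType) (I : seq (R * R)) :
  exists2 ms, schedule I ms & OPT I = cost I ms.
Proof.
have [ms Hms Hmin] := min_cost_from I [::]; exists ms => //.
have lb : lbound [set cost I ms | ms in [set ms | schedule I ms]] (cost I ms).
  by move=> _ [ms' /= Hms' <-]; exact: Hmin.
apply/eqP; rewrite eq_le; apply/andP; split.
  by apply: ge_inf; [exists (cost I ms) | exists ms].
by apply: lb_le_inf => //; exists (cost I ms), ms.
Qed.

Lemma OPT_le (R : realType) (I : seq (R * R)) (ms : seq nat) :
  schedule I ms -> OPT I <= cost I ms.
Proof.
move=> Hms; apply: ge_inf; last by exists ms.
have [ms0 _ Hmin] := min_cost_from I [::].
by exists (cost I ms0) => _ [ms' /= Hms' <-]; exact: Hmin.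
Qed.

(* Main.v *)
(** Identify a file with the interval (b', b] of the time steps that it covers.
    The algorithm keeps the boundary b as long as the reads made since time b
    cost at most the length of the file (b', b]; at the lowest boundary where
    this fails, everything from that file upwards is merged.

    Reads: compare with an arbitrary schedule S.  While S has a boundary in
    (b', b], the read of that file by the algorithm is charged to the read of S
    at that boundary.  When S destroys its last boundary in (b', b], it writes
    the whole of (b', b], and this pays for all the remaining reads of that file
    by the algorithm.  The files being disjoint, the reads of the algorithm cost
    at most as much as S.

    Writes: as l <= alpha r, a merge destroying the boundary b writes at most
    (1 + alpha) times the reads made since time b.  These reads were paid at
    that boundary, and only once, so the writes of the algorithm cost at most
    (1 + alpha) times its reads. *)

Require Import Defs.
From mathcomp Require Import all_boot all_order all_algebra.
From mathcomp Require Import boolp classical_sets reals.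
From mathcomp Require Import lra zify.
Import Order.TTheory GRing.Theory Num.Theory.
Set Implicit Arguments.
Unset Strict Implicit.
Unset Printing Implicit Defensive.
Local Open Scope ring_scope.

(** * Prefix sums, stacks as end times, and the algorithm *)

Definition lsum (R : realType) (I : seq (R * R)) (t : nat) : R :=
  \sum_(i < t) (nth (0, 0) I i).1.

Definition rsum (R : realType) (I : seq (R * R)) (t : nat) : R :=
  \sum_(i < t) (nth (0, 0) I i).2.

(* A stack is encoded by the end times of its files, from top to bottom, a file
   starting where the one below it ends. *)
Fixpoint lengths (R : realType) (P : nat -> R) (B : seq nat) : seq R :=
  if B is b :: B' then (P b - P (head 0%N B')) :: lengths P B' else [::].

(** Merging [m] files, the new one included, forgets the [m.-1] end times below the new one. *)
Fixpoint ends (ms : seq nat) (t : nat) : seq nat :=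
  if t is u.+1 then u.+1 :: drop (nth 0%N ms u).-1 (ends ms u) else [::].

(** The test [keep P Q t B' == B'] lets the lowest failing boundary decide: everything above it goes
    too. *)
Fixpoint keep (R : realType) (P Q : nat -> R) (t : nat) (B : seq nat) :
    seq nat :=
  if B is b :: B' then
    if (keep P Q t B' == B') && (Q t - Q b <= P b - P (head 0%N B')) then B
    else keep P Q t B'
  else [::].

Fixpoint alg_ends (R : realType) (I : seq (R * R)) (t : nat) : seq nat :=
  if t is u.+1 then u.+1 :: keep (lsum I) (rsum I) u.+1 (alg_ends I u)
  else [::].

(** Merging [m] of [k.+1] files leaves [k.+2 - m]; this is solved for [m]. *)
Definition alg (R : realType) (I : seq (R * R)) : seq nat :=
  mkseq (fun t => ((size (alg_ends I t)).+2 - size (alg_ends I t.+1))%N)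
    (size I).

Definition step_cost (R : realType) (I : seq (R * R)) (B : seq nat) (t : nat) :
    R :=
  lsum I t.+1 - lsum I (head 0%N (behead B)) +
  (nth (0, 0) I t).2 * (size B)%:R.

(** * Schedules and their costs in terms of end times *)

Lemma gtn_trans : transitive gtn.
Proof. by move=> y x z /= yx zy; exact: ltn_trans zy yx. Qed.

Lemma path_gtn_drop m x s : path gtn x s -> path gtn x (drop m s).
Proof. exact: (subseq_path gtn_trans (drop_subseq s m)). Qed.

Lemma path_gtn_head x s : path gtn x.+1 s -> (head 0%N s <= x)%N.
Proof. by case: s => //= b s /andP[]. Qed.

Lemma lsumS (R : realType) (I : seq (R * R)) t :
  lsum I t.+1 = lsum I t + (nth (0, 0) I t).1.
Proof. by rewrite /lsum big_ord_recr. Qed.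

Lemma rsumS (R : realType) (I : seq (R * R)) t :
  rsum I t.+1 = rsum I t + (nth (0, 0) I t).2.
Proof. by rewrite /rsum big_ord_recr. Qed.

Lemma nth_instance_ge0 (R : realType) (I : seq (R * R)) t :
  is_instance I -> 0 <= (nth (0, 0) I t).1 /\ 0 <= (nth (0, 0) I t).2.
Proof.
move=> /allP HI; case: (ltnP t (size I)) => Ht; last by rewrite nth_default.
by have /andP[] := HI _ (mem_nth (0, 0) Ht).
Qed.

Lemma sum_take_lengths (R : realType) (P : nat -> R) B m :
  \sum_(x <- take m (lengths P B)) x =
  P (head 0%N B) - P (head 0%N (drop m B)).
Proof.
elim: B m => [|b B IH] [|m] /=; rewrite ?big_nil ?subrr //.
by rewrite big_cons IH addrA subrK.
Qed.

Lemma drop_lengths (R : realType) (P : nat -> R) B m :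
  drop m (lengths P B) = lengths P (drop m B).
Proof. by elim: B m => [|b B IH] [|m] /=. Qed.

Lemma size_lengths (R : realType) (P : nat -> R) B :
  size (lengths P B) = size B.
Proof. by elim: B => //= b B ->. Qed.

Lemma head_ends ms t : head 0%N (ends ms t) = t.
Proof. by case: t. Qed.

Lemma path_ends ms t : path gtn t.+1 (ends ms t).
Proof.
by elim: t => //= t IH; rewrite ltnSn path_gtn_drop.
Qed.

(** Pushing a length amounts to pushing the end time [t.+1]; the merged lengths then telescope. *)
Lemma compact_ends (R : realType) (I : seq (R * R)) ms t :
  (0 < nth 0%N ms t)%N ->
  compact (nth 0%N ms t) ((nth (0, 0) I t).1 :: lengths (lsum I) (ends ms t))
  = lengths (lsum I) (ends ms t.+1).
Proof.
move=> m0.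
have -> : (nth (0, 0) I t).1 :: lengths (lsum I) (ends ms t) =
          lengths (lsum I) (t.+1 :: ends ms t).
  by rewrite /= head_ends lsumS addrAC subrr add0r.
rewrite /compact sum_take_lengths drop_lengths /=.
by case: (nth 0%N ms t) m0.
Qed.

Lemma cost_from_cons (R : realType) (s : seq R) q I m ms :
  let s' := compact m (q.1 :: s) in
  cost_from s (q :: I) (m :: ms) =
  head 0 s' + q.2 * (size s')%:R + cost_from s' I ms.
Proof. by []. Qed.

Lemma feasible_from_size (R : realType) s (I : seq (R * R)) ms :
  feasible_from s I ms -> size ms = size I /\ all (leq 1) ms.
Proof.
elim: I ms s => [|q I IH] [|m ms] s //= /andP[/andP[-> _] /IH[-> ->]].
by [].
Qed.

Lemma cost_ends (R : realType) (I : seq (R * R)) ms :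
  size ms = size I -> all (leq 1) ms ->
  cost I ms = \sum_(0 <= t < size I) step_cost I (ends ms t.+1) t.
Proof.
move=> Hs /(all_nthP 0%N) Hm.
suff H k t : (t + k = size I)%N ->
    cost_from (lengths (lsum I) (ends ms t)) (drop t I) (drop t ms) =
    \sum_(t <= i < size I) step_cost I (ends ms i.+1) i.
  by rewrite -(H (size I) 0%N) // !drop0.
elim: k t => [|k IH] t Hk.
  by rewrite !drop_oversize ?Hs -?Hk ?addn0 // big_geq.
have tI : (t < size I)%N by rewrite -Hk addnS ltnS leq_addr.
rewrite (drop_nth (0, 0) tI) (drop_nth 0%N (n:=t)) ?Hs //.
rewrite [RHS]big_ltn // -IH ?addSnnS // cost_from_cons.
by rewrite compact_ends ?Hm ?Hs // size_lengths.
Qed.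

Lemma feasible_ends (R : realType) (I : seq (R * R)) ms :
  size ms = size I ->
  (forall t, (t < size I)%N ->
     (0 < nth 0%N ms t <= (size (ends ms t)).+1)%N) ->
  schedule I ms.
Proof.
move=> Hs Hm.
suff H k t : (t + k = size I)%N ->
    feasible_from (lengths (lsum I) (ends ms t)) (drop t I) (drop t ms).
  by have := H (size I) 0%N erefl; rewrite !drop0.
elim: k t => [|k IH] t Hk.
  by rewrite !drop_oversize ?Hs -?Hk ?addn0.
have tI : (t < size I)%N by rewrite -Hk addnS ltnS leq_addr.
rewrite (drop_nth (0, 0) tI) (drop_nth 0%N (n:=t)) ?Hs // /=.
have /andP[m0 m1] := Hm _ tI.
by rewrite compact_ends // m0 size_lengths m1 IH ?addSnnS.
Qed.

(** * Feasibility and onlineness of the algorithm *)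

Lemma keepE (R : realType) (P Q : nat -> R) t B :
  keep P Q t B = drop (size B - size (keep P Q t B)) B.
Proof.
elim: B => //= b B IH; case: ifP => _; first by rewrite subnn.
have Hle : (size (keep P Q t B) <= size B)%N by rewrite IH size_drop leq_subr.
by rewrite subSn //= -IH.
Qed.

Lemma size_keep (R : realType) (P Q : nat -> R) t B :
  (size (keep P Q t B) <= size B)%N.
Proof. by rewrite keepE size_drop leq_subr. Qed.

Lemma ends_alg (R : realType) (I : seq (R * R)) t :
  (t <= size I)%N -> ends (alg I) t = alg_ends I t.
Proof.
elim: t => //= t IH tI; rewrite IH ?(ltnW tI) // nth_mkseq //=; congr cons.
rewrite [RHS]keepE subSS; congr drop.
by have := size_keep (lsum I) (rsum I) t.+1 (alg_ends I t); lia.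
Qed.

Lemma alg_bounds (R : realType) (I : seq (R * R)) t : (t < size I)%N ->
  (0 < nth 0%N (alg I) t <= (size (ends (alg I) t)).+1)%N.
Proof.
move=> tI; rewrite nth_mkseq // ends_alg ?(ltnW tI) //=.
have := size_keep (lsum I) (rsum I) t.+1 (alg_ends I t); lia.
Qed.

Lemma alg_algorithm (R : realType) : algorithm (@alg R).
Proof.
by move=> I _; apply: feasible_ends; [rewrite size_mkseq | exact: alg_bounds].
Qed.

(** For onlineness: the decision at time [t] consults the prefix sums only up to [t]. *)
Lemma eq_keep (R : realType) (P Q P' Q' : nat -> R) t B :
  (forall u, (u <= t)%N -> P u = P' u) ->
  (forall u, (u <= t)%N -> Q u = Q' u) -> path gtn t.+1 B ->
  keep P Q t B = keep P' Q' t B.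
Proof.
move=> HP HQ; elim: B => //= b B IH /andP[bt HB].
have HtB := path_le gtn_trans bt HB.
by rewrite IH // !HQ // !HP // path_gtn_head.
Qed.

Lemma path_alg_ends (R : realType) (I : seq (R * R)) t :
  path gtn t.+1 (alg_ends I t).
Proof.
by elim: t => //= t IH; rewrite ltnSn keepE path_gtn_drop.
Qed.

Lemma eq_alg_ends (R : realType) (I J : seq (R * R)) n t :
  take n I = take n J -> (t <= n)%N -> alg_ends I t = alg_ends J t.
Proof.
move=> HIJ; elim: t => //= t IH tn; rewrite -IH ?(ltnW tn) //; congr cons.
have Hnth i : (i < n)%N -> nth (0, 0) I i = nth (0, 0) J i.
  by move=> Hi; rewrite -(nth_take _ Hi) HIJ nth_take.
apply: eq_keep => [u Hu|u Hu|].
- by apply: eq_bigr => i _; rewrite Hnth //; have := ltn_ord i; lia.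
- by apply: eq_bigr => i _; rewrite Hnth //; have := ltn_ord i; lia.
- by apply: (path_le gtn_trans _ (path_alg_ends I t)) => /=.
Qed.

Lemma alg_online (R : realType) : online (@alg R).
Proof.
move=> I J t _ _ tI tJ HIJ; rewrite !nth_mkseq //.
by rewrite !(eq_alg_ends HIJ).
Qed.

(** * Reads of the algorithm against an arbitrary schedule *)

(* The unspent part of the writes by which S, whose stack is O, destroyed its
   last boundaries in the files of A. *)
Fixpoint credit (R : realType) (P Q : nat -> R) (t : nat) (O A : seq nat) : R :=
  if A is b :: A' then
    (if has (fun o => head 0%N A' < o <= b)%N O then 0
     else P b - P (head 0%N A') - (Q t - Q b)) + credit P Q t O A'
  else 0.

(** The invariant maintained by [keep]; it makes every term of [credit] nonnegative. *)
Fixpoint solvent (R : realType) (P Q : nat -> R) (t : nat) (A : seq nat) :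
    bool :=
  if A is b :: A' then
    (Q t - Q b <= P b - P (head 0%N A')) && solvent P Q t A'
  else true.

Lemma solvent_keep (R : realType) (P Q : nat -> R) t A :
  solvent P Q t (keep P Q t A).
Proof.
by elim: A => //= b A IH; case: ifP => //= /andP[/eqP HA ->]; rewrite -HA.
Qed.

Lemma credit_ge0 (R : realType) (P Q : nat -> R) t O A :
  solvent P Q t A -> 0 <= credit P Q t O A.
Proof.
elim: A => //= b A IH /andP[Hb /IH HA].
by case: ifP => _; rewrite ?add0r // addr_ge0 // subr_ge0.
Qed.

Lemma credit_drop (R : realType) (P Q : nat -> R) t O A m :
  solvent P Q t A -> credit P Q t O (drop m A) <= credit P Q t O A.
Proof.
elim: A m => [|b A IH] [|m] //= /andP[Hb HA].
apply: le_trans (IH m HA) _; rewrite lerDr.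
by case: ifP => _ //; rewrite subr_ge0.
Qed.

(** One step on the files [K] that the algorithm keeps, while S drops [m] end times. Each file's
    read is paid by a read of S inside it, by its credit, or by the part of the write of S up to
    [head 0%N K]. *)
Lemma credit_step (R : realType) (P Q : nat -> R) t O K m :
  {homo P : x y / (x <= y)%N >-> x <= y} ->
  {homo Q : x y / (x <= y)%N >-> x <= y} ->
  sorted gtn O -> path gtn t.+1 K ->
  let D := drop m O in
  (Q t.+1 - Q t) * (size K)%:R + credit P Q t.+1 D K <=
  credit P Q t O K + (Q t.+1 - Q t) * (count (fun o => o <= head 0%N K)%N D)%:R
  + (P (maxn (head 0%N K) (head 0%N D)) - P (head 0%N D)).
Proof.
move=> HP HQ HO HK /=; set D := drop m O; set r := Q t.+1 - Q t.
have r0 : 0 <= r by rewrite subr_ge0 HQ.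
elim: K HK => [|b K IH] /=.
  rewrite max0n subrr !mulr0 !addr0 add0r => _.
  by rewrite mulr_ge0 ?ler0n.
move=> /andP[bt HK].
move/(_ (path_le gtn_trans bt HK)): IH => IH.
have bK : (head 0%N K <= b)%N by case: K HK {IH} => //= c K /andP[/ltnW].
set b' := head 0%N K in bK IH *; set d := head 0%N D in IH *.
have HPb : P b' <= P b by exact: HP.
have HQb : Q b <= Q t by exact: HQ.
have Hm : P (maxn b' d) <= P (maxn b d) by apply: HP; lia.
have -> : count (fun o => o <= b)%N D =
    (count (fun o => o <= b')%N D + count (fun o => b' < o <= b)%N D)%N.
  rewrite -count_predUI [X in (_ + X)%N](_ : _ = 0%N); last first.
    by rewrite -(count_pred0 D); apply: eq_count => o /=; lia.
  by rewrite addn0; apply: eq_count => o /=; lia.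
rewrite natrD -[(size K).+1]addn1 natrD !mulrDr mulr1.
(* S still has a boundary in (b', b]: its read there pays [r], and the file has no credit before or
   after. *)
case: ifP => HD.
  have -> : has (fun o => b' < o <= b)%N O.
    by move/hasP: HD => [o /mem_drop oO ob]; apply/hasP; exists o.
  have : r * 1 <= r * (count (fun o => b' < o <= b)%N D)%:R.
    by rewrite ler_wpM2l // ler1n -has_count.
  by lra.
have -> : count (fun o => b' < o <= b)%N D = 0%N.
  by apply/eqP; move: HD; rewrite has_count; case: (count _ _).
(* If S had no boundary there before either, the credit of the file falls by exactly [r]. Otherwise
   S has just destroyed its last one. *)
rewrite mulr0; case: ifP => HOb; last by rewrite /r in IH *; lra.
(* The write of S then covers all of (b', b], hence both [r] and the new credit, as [Q b <= Q t]. *)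
suff db : (d <= b')%N.
  move: Hm IH; rewrite (maxn_idPl db) (maxn_idPl (leq_trans db bK)).
  by rewrite /r; lra.
rewrite /d; case ED : D => [//|d' D'] /=.
have d'D : d' \in D by rewrite ED mem_head.
have /hasP[o oO /andP[bo ob]] := HOb.
(* No end time of [D] lies in (b', b], so [o] was dropped and exceeds all of [D]. *)
have : d' \in D -> (d' < o)%N.
  move: oO; rewrite -(cat_take_drop m O) mem_cat => /orP[oE|oD].
    have : pairwise gtn O by rewrite -(sorted_pairwise gtn_trans).
    rewrite -{1}(cat_take_drop m O) pairwise_cat => /andP[/allrelP Hall _] dD.
    exact: Hall.
  by move/hasPn/(_ o oD): HD; rewrite bo ob.
move=> /(_ d'D) d'o; move/negbT/hasPn/(_ _ d'D): HD; lia.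
Qed.

Lemma lsum_homo (R : realType) (I : seq (R * R)) :
  is_instance I -> {homo lsum I : x y / (x <= y)%N >-> x <= y}.
Proof.
move=> HI; apply: homo_leq => [x|y x z|i]; [exact: lexx|exact: le_trans|].
by rewrite lsumS lerDl; case: (nth_instance_ge0 i HI).
Qed.

Lemma rsum_homo (R : realType) (I : seq (R * R)) :
  is_instance I -> {homo rsum I : x y / (x <= y)%N >-> x <= y}.
Proof.
move=> HI; apply: homo_leq => [x|y x z|i]; [exact: lexx|exact: le_trans|].
by rewrite rsumS lerDl; case: (nth_instance_ge0 i HI).
Qed.

Lemma solvent_alg_ends (R : realType) (I : seq (R * R)) t :
  is_instance I -> solvent (lsum I) (rsum I) t (alg_ends I t).
Proof.
move=> HI; case: t => //= t; rewrite subrr solvent_keep andbT subr_ge0.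
apply: lsum_homo => //; rewrite keepE.
by apply: leqW; apply: path_gtn_head; rewrite path_gtn_drop ?path_alg_ends.
Qed.

(** Both top files end at [t.+1]: their reads cancel, and the new file of the algorithm carries no
    credit. For the other files use [credit_step], after [credit_drop] for the merged ones. *)
Lemma alg_reads_step (R : realType) (I : seq (R * R)) ms t :
  is_instance I ->
  (nth (0, 0) I t).2 * (size (alg_ends I t.+1))%:R +
    credit (lsum I) (rsum I) t.+1 (ends ms t.+1) (alg_ends I t.+1) <=
  credit (lsum I) (rsum I) t (ends ms t) (alg_ends I t) +
    step_cost I (ends ms t.+1) t.
Proof.
move=> HI; set r := (nth _ _ _).2.
have HP := lsum_homo HI; have HQ := rsum_homo HI.
have r0 : 0 <= r by case: (nth_instance_ge0 t HI).
set K := keep (lsum I) (rsum I) t.+1 (alg_ends I t).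
have HK : path gtn t.+1 K by have /= /andP[] := path_alg_ends I t.+1.
have hK := path_gtn_head HK.
set m := (nth 0%N ms t).-1; set D := drop m (ends ms t).
have HO : sorted gtn (ends ms t) by exact: path_sorted (path_ends ms t).
have hD : (head 0%N D <= t)%N.
  by rewrite path_gtn_head ?path_gtn_drop ?path_ends.
have -> : credit (lsum I) (rsum I) t.+1 (ends ms t.+1) (alg_ends I t.+1) =
    credit (lsum I) (rsum I) t.+1 D K.
  rewrite /= -/K -/m -/D leqnn ltnS hK /= add0r.
  (* The end time [t.+1] lies above every file of [K]. *)
  elim: (K) HK => //= b B IH /andP[bt HB].
  by rewrite IH ?(path_le gtn_trans bt HB) // (leqNgt t.+1 b) bt andbF.
have := credit_step m HP HQ HO HK; rewrite -/D rsumS addrAC subrr add0r -/r /=.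
have Hphi : credit (lsum I) (rsum I) t (ends ms t) K <=
    credit (lsum I) (rsum I) t (ends ms t) (alg_ends I t).
  by rewrite /K keepE; apply: credit_drop; exact: solvent_alg_ends.
have Hc : r * (count (fun o => o <= head 0%N K)%N D)%:R <= r * (size D)%:R.
  by rewrite ler_wpM2l // ler_nat count_size.
have HPm : lsum I (maxn (head 0%N K) (head 0%N D)) <= lsum I t.+1.
  by apply: HP; lia.
rewrite /step_cost /= -/K -/m -/D -/r -![(size _).+1]addn1 !natrD !mulrDr mulr1.
lra.
Qed.

Lemma alg_reads (R : realType) (I : seq (R * R)) ms :
  is_instance I -> schedule I ms ->
  \sum_(0 <= t < size I) (nth (0, 0) I t).2 * (size (alg_ends I t.+1))%:R
  <= cost I ms.
Proof.
move=> HI /feasible_from_size[Hs Hm]; rewrite cost_ends //.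
pose phi u := credit (lsum I) (rsum I) u (ends ms u) (alg_ends I u).
suff H n : \sum_(0 <= t < n) (nth (0, 0) I t).2 * (size (alg_ends I t.+1))%:R
    + phi n <= \sum_(0 <= t < n) step_cost I (ends ms t.+1) t.
  apply: le_trans (H _); rewrite lerDl.
  by apply: credit_ge0; exact: solvent_alg_ends.
elim: n => [|n IH]; first by rewrite !big_geq // add0r.
rewrite !big_nat_recr //=.
have := alg_reads_step ms n HI; rewrite -/(phi n) -/(phi n.+1) /=.
by move: IH; rewrite /=; lra.
Qed.

(** * Writes of the algorithm against its reads *)

(** At the lowest failing boundary [b], the file ending there is shorter than [Q t.+1 - Q b], and
    what lies above it is at most [a] times that. The destroyed boundaries release their reads up to
    [t]; the current read is added once. *)
Lemma keep_write (R : realType) (P Q : nat -> R) (a : R) t B :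
  0 <= a ->
  {homo Q : x y / (x <= y)%N >-> x <= y} ->
  (forall b, (b <= t.+1)%N -> P t.+1 - P b <= a * (Q t.+1 - Q b)) ->
  path gtn t.+1 B ->
  keep P Q t.+1 B = B \/
  P t.+1 - P (head 0%N (keep P Q t.+1 B)) <=
  (1 + a) * (\sum_(b <- B) (Q t - Q b) -
    \sum_(b <- keep P Q t.+1 B) (Q t - Q b) + (Q t.+1 - Q t)).
Proof.
move=> a0 HQ HPQ; elim: B => [|b B IH] /=; first by left.
move=> /andP[bt HB]; have HtB := path_le gtn_trans bt HB.
have Qb : Q b <= Q t by exact: HQ.
case: ifP => [_|HF]; [by left | right].
move: HF; rewrite big_cons; case: (IH HtB) => [->|HK].
  rewrite eqxx /= => /negbT; rewrite -ltNge => Hb.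
  by have := HPQ b (ltnW bt); rewrite mulrDl mul1r; lra.
(* A destroyed boundary above the failing one only releases more, as [Q b <= Q t]. *)
move=> _; apply: le_trans HK _; rewrite ler_wpM2l ?addr_ge0 //; lra.
Qed.

Lemma lsum_le_rsum (R : realType) (I : seq (R * R)) (a : R) t b :
  (forall q, q \in I -> q.1 <= a * q.2) -> (b <= t)%N ->
  lsum I t - lsum I b <= a * (rsum I t - rsum I b).
Proof.
move=> HI /subnK <-; elim: (t - b)%N => [|k IH].
  by rewrite !add0n !subrr mulr0.
rewrite addSn lsumS rsumS.
suff : (nth (0, 0) I (k + b)).1 <= a * (nth (0, 0) I (k + b)).2 by lra.
case: (ltnP (k + b) (size I)) => Hk; first by apply: HI; exact: mem_nth.
by rewrite nth_default //= mulr0.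
Qed.

(** The potential is [1 + a] times the reads accumulated at the present boundaries. The new boundary
    has accumulated none, so its own read is free to pay for the write. *)
Lemma alg_write_step (R : realType) (I : seq (R * R)) (a : R) t :
  is_instance I -> 0 <= a -> (forall q, q \in I -> q.1 <= a * q.2) ->
  lsum I t.+1 - lsum I (head 0%N (behead (alg_ends I t.+1))) +
    (1 + a) * \sum_(b <- alg_ends I t.+1) (rsum I t.+1 - rsum I b) <=
  (1 + a) * \sum_(b <- alg_ends I t) (rsum I t - rsum I b) +
    (1 + a) * ((nth (0, 0) I t).2 * (size (alg_ends I t.+1))%:R).
Proof.
move=> HI a0 Ha; rewrite /= big_cons subrr add0r.
set K := keep _ _ _ _; set r := (nth _ _ _).2.
have r0 : 0 <= r by case: (nth_instance_ge0 t HI).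
have -> : \sum_(b <- K) (rsum I t.+1 - rsum I b) =
    \sum_(b <- K) (rsum I t - rsum I b) + r * (size K)%:R.
  rewrite -sum1_size natr_sum mulr_sumr -big_split /=.
  by apply: eq_bigr => b _; rewrite rsumS mulr1 addrAC.
rewrite -[(size K).+1]addn1 natrD !mulrDr mulr1.
have := @keep_write _ (lsum I) (rsum I) a t (alg_ends I t) a0 (rsum_homo HI)
  (fun b Hb => lsum_le_rsum Ha Hb) (path_alg_ends I t).
have -> : rsum I t.+1 - rsum I t = r by rewrite rsumS addrAC subrr add0r.
(* If nothing is merged, only the new length is written, and it is at most [a * r]. *)
rewrite -/K => -[KE|]; last by lra.
have := lsum_le_rsum Ha (leqnSn t); rewrite rsumS -/r.
have -> : head 0%N K = t by rewrite KE; case: (t).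
by rewrite KE; lra.
Qed.

Lemma alg_writes (R : realType) (I : seq (R * R)) (a : R) :
  is_instance I -> 0 <= a -> (forall q, q \in I -> q.1 <= a * q.2) ->
  \sum_(0 <= t < size I)
    (lsum I t.+1 - lsum I (head 0%N (behead (alg_ends I t.+1)))) <=
  (1 + a) * \sum_(0 <= t < size I)
    (nth (0, 0) I t).2 * (size (alg_ends I t.+1))%:R.
Proof.
move=> HI a0 Ha.
pose psi t := (1 + a) * \sum_(b <- alg_ends I t) (rsum I t - rsum I b).
suff H n : \sum_(0 <= t < n)
      (lsum I t.+1 - lsum I (head 0%N (behead (alg_ends I t.+1)))) + psi n <=
    (1 + a) * \sum_(0 <= t < n)
      (nth (0, 0) I t).2 * (size (alg_ends I t.+1))%:R.
  apply: le_trans (H _); rewrite lerDl mulr_ge0 ?addr_ge0 // big_seq.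
  apply: sumr_ge0 => b Hb; rewrite subr_ge0 rsum_homo //.
  have /(order_path_min gtn_trans)/allP := path_alg_ends I (size I).
  by move=> /(_ b Hb).
elim: n => [|n IH]; first by rewrite /psi !big_geq //= big_nil !mulr0 addr0.
rewrite !big_nat_recr // mulrDr.
have := alg_write_step n HI a0 Ha; rewrite -/(psi n) -/(psi n.+1).
by move: IH; rewrite /=; lra.
Qed.

(** * The competitive ratio *)

Theorem theorem3 (R : realType) :
  exists A : seq (R * R) -> seq nat,
    algorithm A /\ online A /\
    forall alpha : R, 1 <= alpha ->
      exists c : R, forall I : seq (R * R),
        is_instance I ->
        (forall q : R * R, q \in I -> q.1 <= alpha * q.2) ->
        alg_cost A I <= c * OPT I.
Proof.
exists (@alg R); split; first exact: alg_algorithm.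
split; first exact: alg_online.
(* The reads count once and the writes [1 + alpha] times the reads. *)
move=> alpha alpha1; exists (2 + alpha) => I HI Ha.
have alpha0 : 0 <= alpha by exact: le_trans ler01 alpha1.
have [ms Hms ->] := OPT_attained I.
have [Hs Hm] := feasible_from_size (alg_algorithm HI).
have -> : alg_cost (@alg R) I =
    \sum_(0 <= t < size I) step_cost I (alg_ends I t.+1) t.
  rewrite /alg_cost cost_ends //; apply: eq_big_nat => t /andP[_ tI].
  by rewrite ends_alg.
rewrite /step_cost big_split /=.
apply: le_trans (_ : (2 + alpha) * \sum_(0 <= t < size I)
    (nth (0, 0) I t).2 * (size (alg_ends I t.+1))%:R <= _).
  have := alg_writes HI alpha0 Ha; lra.
by rewrite ler_wpM2l ?addr_ge0 //; exact: alg_reads.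
Qed.
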